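(* Let $L$ be a finite trim lattice with a maximal chain $\hat0=x_0\lessdot x_1\lessdot\cdots\lessdot x_n=\hat1$ of left modular elements, where $L$ has exactly $n$ join-irreducibles and $n$ meet-irreducibles. For a join-irreducible $v$ let $\delta(v)=\min\{i: v\le x_i\}$, and for a covering relation $y\lessdot z$ let $\gamma(y\lessdot z)=\min\{\delta(v): v\text{ join-irreducible}, v\le z, v\not\le y\}$. If $y$ and $z$ both cover $w$ and $\gamma(w\lessdot y)<\gamma(w\lessdot z)$, then $y\vee z$ covers $z$.
   Context: An element $x$ of a lattice $L$ is left modular if for all $y<z$ in $L$, $(y\vee x)\wedge z=y\vee(x\wedge z)$. A join-irreducible is an element other than $\hat0$ that is not the join of two strictly smaller elements; a meet-irreducible is an element other than $\hat1$ that is not the meet of two strictly larger elements. A lattice is trim if, for some $n$, it has a maximal chain of $n+1$ left modular elements and exactly $n$ join-irreducibles and exactly $n$ meet-irreducibles. $y\lessdot z$ means $z$ covers $y$. *)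

(* Defs.v *)
From mathcomp Require Import all_boot all_order.

Set Implicit Arguments.
Unset Strict Implicit.
Unset Printing Implicit Defensive.

Import Order.TTheory.

Local Open Scope order_scope.

(* covers y z is y <. z, that is, z covers y. *)
Definition covers (d : Order.disp_t) (L : finPOrderType d) (y z : L) : bool :=
  (y < z) && [forall t : L, ~~ ((y < t) && (t < z))].

Definition left_modular (d : Order.disp_t) (L : latticeType d) (x : L) : Prop :=
  forall y z : L, y < z -> (y `|` x) `&` z = y `|` (x `&` z).

Definition join_irreducible (d : Order.disp_t) (L : finTBLatticeType d)
    (v : L) : bool :=
  (v != \bot) &&
  [forall a : L, forall b : L, (a < v) && (b < v) ==> (v != a `|` b)].

Definition meet_irreducible (d : Order.disp_t) (L : finTBLatticeType d)
    (v : L) : bool :=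
  (v != \top) &&
  [forall a : L, forall b : L, (v < a) && (v < b) ==> (v != a `&` b)].

(* A chain x_0, ..., x_n witnessing trimness: L is trim if and only if
   trim_chain x holds for some n and some x. *)
Definition trim_chain (d : Order.disp_t) (L : finTBLatticeType d) (n : nat)
    (x : 'I_n.+1 -> L) : Prop :=
  [/\ x ord0 = \bot /\ x ord_max = \top,
      forall i j : 'I_n.+1, (j = i.+1 :> nat)%N -> covers (x i) (x j),
      forall i : 'I_n.+1, left_modular (x i),
      #|[set v : L | join_irreducible v]| = n
    & #|[set v : L | meet_irreducible v]| = n].

(* Both minima range over values in {0, ..., n}, so starting them at n matters
   only for an empty family. The family is nonempty in delta as soon as x_n is
   the top element, and in gamma as soon as y < z. *)
Definition delta (d : Order.disp_t) (L : finTBLatticeType d) (n : nat)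
    (x : 'I_n.+1 -> L) (v : L) : nat :=
  \big[minn/n]_(i < n.+1 | v <= x i) (i : nat).

Definition gamma (d : Order.disp_t) (L : finTBLatticeType d) (n : nat)
    (x : 'I_n.+1 -> L) (y z : L) : nat :=
  \big[minn/n]_(v : L | [&& join_irreducible v, v <= z & ~~ (v <= y)])
    delta x v.

(* Main.v *)
(** Each step x_i < x_(i+1) of the chain is separated by some join-irreducible
    v (v below x_(i+1) but not below x_i) and, dually, by some meet-irreducible;
    by the cardinality assumptions both are unique. Put u = y \/ z and let v be a
    join-irreducible below u, not below w, of least delta, say i + 1, so that
    x_i /\ u <= w. If delta v < gamma (w, y), then v is below neither y nor z,
    and left modularity of x_i gives v not below y \/ x_i nor z \/ x_i; hence the
    meet-irreducible of step i lies above y and above z but not above v <= y \/ z,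
    a contradiction. Otherwise v is the join-irreducible realising gamma (w, y),
    so that u = z \/ v, and for z < t < u one finds x_(i+1) /\ t <= z, whence
    t = (z \/ x_(i+1)) /\ t = z \/ (x_(i+1) /\ t) = z. *)
Require Import Defs.
From mathcomp Require Import all_boot all_order.

Import Order.TTheory.

Local Open Scope order_scope.

Lemma bigminn_le (I : finType) (P : pred I) (F : I -> nat) (n : nat) (i : I) :
  P i -> (\big[minn/n]_(j | P j) F j <= F i)%N.
Proof.
move=> Pi; elim: (index_enum I) (mem_index_enum i) => // j r IH.
rewrite inE big_cons => /predU1P[<-|/IH le_i]; first by rewrite Pi geq_minl.
by case: ifP => // _; rewrite geq_min le_i orbT.
Qed.

(** The fold may return its default [n]; then [F i0 <= n] forces [F i0 = n], so [i0] attains it. *)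
Lemma bigminn_attained (I : finType) (P : pred I) (F : I -> nat) (n : nat)
    (i0 : I) :
  P i0 -> (F i0 <= n)%N ->
  exists2 i, P i & F i = \big[minn/n]_(j | P j) F j.
Proof.
move=> Pi0 le_n.
have : \big[minn/n]_(j | P j) F j = n \/
    exists2 i, P i & F i = \big[minn/n]_(j | P j) F j.
  elim/big_rec: _ => [|i m Pi IH]; first by left.
  by have [le_im|//] := leqP (F i) m; right; exists i.
case=> // eq_n; exists i0 => //; apply/eqP.
by rewrite eqn_leq bigminn_le // eq_n le_n.
Qed.

(** Choosing a separator for each index gives an injection of ['I_n] into [S], which is onto by
    cardinality. So every element of [S] is the chosen separator of some index, and it separates no
    other. *)
Lemma separator_unique (n : nat) (T : finType) (S : {set T})
    (P : 'I_n -> pred T) :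
  #|S| = n ->
  (forall i j v, P i v -> P j v -> i = j) ->
  (forall i, exists2 v, v \in S & P i v) ->
  forall i v v', v \in S -> v' \in S -> P i v -> P i v' -> v = v'.
Proof.
move=> cardS P_inj P_ex.
have exb i : exists v, (v \in S) && P i v.
  by have [v Sv Pv] := P_ex i; exists v; rewrite Sv.
pose f i := xchoose (exb i).
have /all_and2 [fS fP] i : f i \in S /\ P i (f i).
  exact/andP/(xchooseP (exb i)).
have f_inj : injective f.
  by move=> i j eq_f; apply: (P_inj _ _ (f i)) => //; rewrite eq_f.
have imf : [set f i | i in 'I_n] = S.
  apply/eqP; rewrite eqEcard card_imset // card_ord cardS leqnn andbT.
  by apply/subsetP => _ /imsetP[i _ ->].
move=> i v v'; rewrite -imf => /imsetP[j _ ->] /imsetP[k _ ->] Pj Pk.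
by rewrite (P_inj _ _ _ Pj (fP j)) in Pk *; rewrite (P_inj _ _ _ Pk (fP k)).
Qed.

(** Among the elements below [a] but not below [b], take one with the smallest down-set: everything
    strictly under it lies below [b], hence so does any join of two such elements. *)
Lemma exists_join_irreducible (d : Order.disp_t) (L : finTBLatticeType d)
    (a b : L) :
  ~~ (a <= b) -> exists v, [/\ join_irreducible v, v <= a & ~~ (v <= b)].
Proof.
move=> nab; pose P v := (v <= a) && ~~ (v <= b).
have Pa : P a by rewrite /P lexx.
case: (arg_minnP (fun v : L => #|[set t | t <= v]|) Pa) => v /andP[va vb] vmin.
have below p : p < v -> p <= b.
  move=> pv; apply: contraT => npb.
  have : P p by rewrite /P npb (le_trans (ltW pv)).
  move/vmin; rewrite leqNgt proper_card //; apply/properP; split.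
    by apply/subsetP => t; rewrite !inE => /le_trans; apply; apply: ltW.
  by exists v; rewrite inE ?lexx // lt_geF.
exists v; split=> //; apply/andP; split.
  by apply: contraNneq vb => ->; apply: le0x.
apply/forallP => p; apply/forallP => q; apply/implyP => /andP[pv qv].
by apply: contraNneq vb => ->; rewrite leUx !below.
Qed.

Lemma exists_meet_irreducible (d : Order.disp_t) (L : finTBLatticeType d)
    (a b : L) :
  ~~ (a <= b) -> exists m, [/\ meet_irreducible m, b <= m & ~~ (a <= m)].
Proof. exact: (@exists_join_irreducible _ L^d b a). Qed.

Section TrimChain.

Variables (d : Order.disp_t) (L : finTBLatticeType d) (n : nat).
Variables (x : 'I_n.+1 -> L) (hx : trim_chain x).

Let lo (i : 'I_n) : L := x (widen_ord (leqnSn n) i).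
Let hi (i : 'I_n) : L := x (lift ord0 i).

Lemma trim_chain_homo (i j : 'I_n.+1) : (i <= j)%N -> x i <= x j.
Proof.
case: hx => _ cov _ _ _.
suff H k (kn : (k < n.+1)%N) : (i <= k)%N -> x i <= x (Ordinal kn).
  by case: j => k kn; apply: H.
elim: k kn => [|k IH] kn.
  by rewrite leqn0 => /eqP i0; rewrite (_ : Ordinal kn = i) //; apply: val_inj.
rewrite leq_eqVlt => /predU1P[ik|ik].
  by rewrite (_ : Ordinal kn = i) //; apply: val_inj.
apply: le_trans (IH (ltnW kn) ik) _.
by have /andP[/ltW] := cov (Ordinal (ltnW kn)) (Ordinal kn) erefl.
Qed.

Lemma step_lt (i : 'I_n) : lo i < hi i.
Proof. by case: hx => _ cov _ _ _; case/andP: (cov (widen_ord (leqnSn n) i) _ (lift0 i)). Qed.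

Lemma delta_le (v : L) (i : 'I_n.+1) : (delta x v <= i)%N = (v <= x i).
Proof.
have [[_ x1] _ _ _ _] := hx; apply/idP/idP => [le_i|]; last first.
  exact: (bigminn_le _ (fun j : 'I_n.+1 => v <= x j) (@nat_of_ord n.+1)).
have [|j vj dj] := @bigminn_attained _ (fun j : 'I_n.+1 => v <= x j)
  (@nat_of_ord n.+1) n ord_max _ (leqnn n).
  by rewrite x1 lex1.
by apply: le_trans vj (trim_chain_homo _ _ _); rewrite dj.
Qed.

Lemma delta_le_n (v : L) : (delta x v <= n)%N.
Proof. by have [[_ x1] _ _ _ _] := hx; rewrite (delta_le v ord_max) x1 lex1. Qed.

Lemma delta_step (i : 'I_n) (v : L) :
  (delta x v == i.+1) = (v <= hi i) && ~~ (v <= lo i).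
Proof. by rewrite -!delta_le lift0 -ltnNge eqn_leq. Qed.

Lemma join_irreducible_step (v : L) :
  join_irreducible v -> exists i : 'I_n, delta x v = i.+1.
Proof.
case/andP=> v0 _; have [[x0 _] _ _ _ _] := hx.
case E: (delta x v) => [|k]; last first.
  by have := delta_le_n v; rewrite E => kn; exists (Ordinal kn).
(* The value 0 would put [v] below [x ord0], the bottom. *)
by move/eqP: E; rewrite -leqn0 (delta_le v ord0) x0 lex0 (negPf v0).
Qed.

Lemma delta_inj (v v' : L) :
  join_irreducible v -> join_irreducible v' -> delta x v = delta x v' -> v = v'.
Proof.
move=> jv jv' eq_d; have [i di] := join_irreducible_step _ jv.
have [_ _ _ cJ _] := hx.
apply: (separator_unique _ _ _ (fun i v => delta x v == i.+1) cJ _ _ i);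
  rewrite ?inE -?eq_d ?di //.
  by move=> j k t /eqP-> /eqP[]; apply: val_inj.
move=> j; have [|t [jt th tl]] := exists_join_irreducible _ _ (hi j) (lo j).
  by rewrite lt_geF ?step_lt.
by exists t; rewrite ?inE // delta_step th.
Qed.

Lemma meet_separator_inj (i : 'I_n) (m m' : L) :
  meet_irreducible m -> meet_irreducible m' ->
  lo i <= m -> ~~ (hi i <= m) -> lo i <= m' -> ~~ (hi i <= m') -> m = m'.
Proof.
move=> jm jm' lm hm lm' hm'; have [_ _ _ _ cM] := hx.
pose P (i : 'I_n) (m : L) := (lo i <= m) && ~~ (hi i <= m).
apply: (separator_unique _ _ _ P cM _ _ i);
  rewrite ?inE /P ?lm ?lm' //.
  (* If [k < j], then [hi k <= lo j <= t], against [P k t]. *)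
  have P_le j k t : P j t -> P k t -> (j <= k)%N.
    case/andP=> lj _ /andP[_]; apply: contraR; rewrite -ltnNge => lt_kj.
    by apply: le_trans lj; apply: trim_chain_homo; rewrite lift0.
  move=> j k t Pj Pk; apply/val_inj/eqP.
  by rewrite eqn_leq (P_le _ _ _ Pj Pk) (P_le _ _ _ Pk Pj).
move=> j; have [|t [jt th tl]] := exists_meet_irreducible _ _ (hi j) (lo j).
  by rewrite lt_geF ?step_lt.
by exists t; rewrite ?inE // th.
Qed.

Lemma gamma_attained (y z : L) :
  ~~ (z <= y) ->
  exists v, [/\ join_irreducible v, v <= z, ~~ (v <= y) & delta x v = gamma x y z].
Proof.
move=> nzy; have [v [jv vz vy]] := exists_join_irreducible _ _ _ _ nzy.
have [|t /and3P[jt tz ty] eq_t] := @bigminn_attained _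
  (fun v => [&& join_irreducible v, v <= z & ~~ (v <= y)]) (delta x) n v _
  (delta_le_n v).
  by rewrite jv vz.
by exists t.
Qed.

Lemma gamma_le (y z v : L) :
  join_irreducible v -> v <= z -> ~~ (v <= y) -> (gamma x y z <= delta x v)%N.
Proof. by move=> jv vz vy; apply: bigminn_le; rewrite jv vz. Qed.

Lemma left_modular_le (i : 'I_n.+1) (a b : L) :
  a <= b -> (a `|` x i) `&` b = a `|` (x i `&` b).
Proof.
have [_ _ lm _ _] := hx; rewrite le_eqVlt => /predU1P[->|]; last exact: lm.
by rewrite (meet_r (leUl _ _)) (join_l (leIr _ _)).
Qed.

(** Left modularity of [lo i] collapses the meet of [a \/ lo i] with [u] to [a], so [v] is not below
    [a \/ lo i]. A meet-irreducible above that join and not above [v] cannot be above [hi i], as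
    [v <= hi i]. *)
Lemma meet_separator (i : 'I_n) (u v a : L) :
  v <= hi i -> v <= u -> ~~ (v <= a) -> a <= u -> lo i `&` u <= a ->
  exists m, [/\ meet_irreducible m, lo i <= m, ~~ (hi i <= m), a <= m
              & ~~ (v <= m)].
Proof.
move=> vhi vu nva au loa.
have nv : ~~ (v <= a `|` lo i).
  apply: contra nva => v_le; have : v <= (a `|` lo i) `&` u by rewrite lexI v_le.
  by rewrite left_modular_le // (join_l loa).
have [m [jm + vm]] := exists_meet_irreducible _ _ _ _ nv.
rewrite leUx => /andP[am lom]; exists m; split=> //.
by apply: contra vm; apply: le_trans.
Qed.

Theorem covers_join (w y z : L) :
  covers w y -> covers w z -> (gamma x w y < gamma x w z)%N ->
  covers z (y `|` z).
Proof.
move=> /andP[wy /forallP cwy] /andP[wz _] lt_g.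
have [|vy [jvy vyy vyw dvy]] := gamma_attained w y; first by rewrite lt_geF.
set u := y `|` z.
have yu : y <= u by apply: leUl.
have zu : z <= u by apply: leUr.
pose Q v := [&& join_irreducible v, v <= u & ~~ (v <= w)].
have Qvy : Q vy by rewrite /Q jvy vyw (le_trans vyy).
case: (arg_minnP (delta x) Qvy) => v /and3P[jv vu vw] vmin.
have [i dv] := join_irreducible_step _ jv.
have /andP[vhi vlo] : (v <= hi i) && ~~ (v <= lo i) by rewrite -delta_step dv.
(* A join-irreducible violating this would satisfy [Q] with [delta] at most [i], below the minimum
   [i.+1]. *)
have lou : lo i `&` u <= w.
  apply: contraT => /exists_join_irreducible[t [jt]].
  rewrite lexI => /andP[tlo tu] tw; have /vmin : Q t by rewrite /Q jt tu.
  by rewrite dv leqNgt ltnS (delta_le t (widen_ord (leqnSn n) i)) tlo.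
have le_d : (delta x v <= gamma x w y)%N by rewrite -dvy vmin.
(* Otherwise [gamma x w z <= delta x v <= gamma x w y]. *)
have vz : ~~ (v <= z).
  apply: contraL (leq_ltn_trans le_d lt_g) => vz.
  by rewrite -leqNgt gamma_le.
have vy_v : vy = v.
  apply: delta_inj => //; apply/eqP; rewrite eqn_leq vmin // andbT dvy leqNgt.
  apply/negP => lt_d; have vny : ~~ (v <= y).
    by apply: contraL lt_d => vy'; rewrite -leqNgt gamma_le.
  have [m [jm lom him ym vm]] :=
    meet_separator _ _ _ _ vhi vu vny yu (le_trans lou (ltW wy)).
  have [m' [jm' lom' him' zm' _]] :=
    meet_separator _ _ _ _ vhi vu vz zu (le_trans lou (ltW wz)).
  have mm' := meet_separator_inj i _ _ jm jm' lom him lom' him'.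
  by case/negP: vm; apply: le_trans vu _; rewrite leUx ym mm' zm'.
(* As [v = vy] is below [y] but not below [w], the join [w \/ v] lies strictly above [w] and below
   [y], so the cover makes it [y]. *)
have y_wv : y <= w `|` v.
  have := cwy (w `|` v); rewrite lt_neqAle leUl andbT -vy_v negb_and negbK.
  case/orP=> [/eqP E|]; first by case/negP: vyw; rewrite E leUr.
  by rewrite lt_neqAle leUx (ltW wy) vyy !andbT negbK => /eqP->.
have u_le t : z <= t -> v <= t -> u <= t.
  move=> zt vt; rewrite leUx zt andbT; apply: le_trans y_wv _.
  by rewrite leUx vt (le_trans (ltW wz)).
apply/andP; split.
  by rewrite lt_neqAle zu andbT; apply: contraNneq vz => ->.
apply/forallP => t; apply/negP => /andP[zt tu].
(* A join-irreducible [s] violating this satisfies [Q] and has [delta] at most [i.+1], so [s = v] by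
   minimality and [delta_inj]; then [t] is above [z] and [v], hence above [u]. *)
have hit : hi i `&` t <= z.
  apply: contraT => /exists_join_irreducible[s [js]].
  rewrite lexI => /andP[shi st] sz; have /vmin ds : Q s.
    by rewrite /Q js (le_trans st (ltW tu)) (contra _ sz) // => /le_trans ->//; apply: ltW.
  have sv : s = v.
    apply: delta_inj => //; apply/eqP.
    by rewrite eqn_leq ds andbT dv -(lift0 i) delta_le.
  by rewrite sv in st; rewrite -(lt_geF tu) u_le // ltW.
(* Since [v <= hi i], the join [z \/ hi i] is above [u], hence above [t]. *)
have : t <= (z `|` hi i) `&` t.
  rewrite lexI lexx andbT; apply: le_trans (ltW tu) (u_le _ _ _); rewrite ?leUl //.
  by apply: le_trans vhi (leUr _ _).
by rewrite left_modular_le ?(ltW zt) // (join_l hit) (lt_geF zt).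
Qed.

End TrimChain.

Theorem theorem6 (d : Order.disp_t) (L : finTBLatticeType d) (n : nat)
    (x : 'I_n.+1 -> L) (hx : trim_chain x) (w y z : L)
    (hy : covers w y) (hz : covers w z)
    (hgamma : (gamma x w y < gamma x w z)%N) :
  covers z (y `|` z).
Proof. exact: (@covers_join d L n x hx w y z hy hz hgamma). Qed.
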